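(* Let $K$ be an algebraically closed field with $\operatorname{char}(K)\neq 2$. Up to isomorphism there exist exactly $9$ commutative nilpotent associative algebras of dimension $4$ over $K$: every such algebra is isomorphic to one of the following pairwise non-isomorphic commutative nilpotent associative algebras, each with basis $a,b,c,d$ and the indicated nonzero products. With central component: - $J_{4,1}$: all products are zero; - $J_{4,2}$: $a^2=b$; - $J_{4,3}$: $a^2=c,\ b^2=c$; - $J_{4,4}$: $a^2=b,\ a\circ b=c$. Without central component: - $J_{4,5}$: $a^2=d,\ b^2=d,\ c^2=d$; - $J_{4,7}$: $a^2=b,\ a\circ b=d,\ c^2=d$; - $J_{4,11}$: $a^2=b,\ a\circ b=c,\ a\circ c=d,\ b^2=d$; - $J_{4,12}$: $a^2=c,\ a\circ b=d$; - $J_{4,13}$: $a^2=c,\ b^2=c,\ a\circ b=d$.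
   Context: The product of an algebra $J$ is denoted $\circ$, and $x^2=x\circ x$. Algebras are not required to have a unit. Set $c^1(J)=J$ and $c^m(J)=c^{m-1}(J)\circ J$ (the span of the products) for $m\geq 2$; $J$ is nilpotent if $c^n(J)=0$ for some $n$. The centre of a commutative algebra $J$ is here $Z(J)=\{x\in J: x\circ y=0\ \forall y\in J\}$. $J$ has a central component if $J=I_1\oplus I_2$ is a direct sum of two ideals with $I_2$ nonzero and contained in $Z(J)$. In the multiplication tables, all products of basis vectors that are not listed (and do not follow from commutativity) are zero. *)

(* Defs.v *)
(* An algebra (not necessarily associative or unital) on a
   finite-dimensional space V is a bilinear product {bilinear V -> V -> V}. *)
From HB Require Import structures.
From mathcomp Require Import all_boot all_order all_algebra.

Set Implicit Arguments.
Unset Strict Implicit.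
Unset Printing Implicit Defensive.

Import GRing.Theory.
Local Open Scope ring_scope.

Section Algebra.

Variables (K : fieldType) (V : vectType K) (mul : {bilinear V -> V -> V}).

(* The span of the products mul u v with u in U and v in W, encoded as prodv is
   for unital algebras; mul_vspaceP is its universal property. *)
Definition mul_vspace (U W : {vspace V}) : {vspace V} :=
  <<[seq mul u w | u <- vbasis U, w <- vbasis W]>>%VS.

Lemma mem_mul_vspace (U W : {vspace V}) :
  {in U & W, forall u w, mul u w \in mul_vspace U W}.
Proof.
move=> u w /coord_vbasis-> /coord_vbasis->.
rewrite linear_sumlz; apply: memv_suml => i _.
rewrite linear_sumr; apply: memv_suml => j _.
rewrite linearZl_LR linearZr_LR !memvZ // memv_span //.
by apply/allpairsP; exists ((vbasis U)`_i, (vbasis W)`_j); rewrite !memt_nth.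
Qed.

Lemma mul_vspaceP (U W X : {vspace V}) :
  reflect {in U & W, forall u w, mul u w \in X} (mul_vspace U W <= X)%VS.
Proof.
apply: (iffP idP) => [sX u w Uu Ww | sX].
  by rewrite (subvP sX) ?mem_mul_vspace.
apply/span_subvP=> _ /allpairsP[[u w] /= [Uu Ww ->]].
by rewrite sX ?vbasis_mem.
Qed.

(* Indexed from 0: power_ideal n is c^{n+1}(V). *)
Fixpoint power_ideal (n : nat) : {vspace V} :=
  if n is m.+1 then mul_vspace (power_ideal m) fullv else fullv.

Definition nilpotent_alg : Prop := exists n, power_ideal n = 0%VS.

Definition comm_nilp_assoc : Prop :=
  [/\ commutative mul, associative mul & nilpotent_alg].

(* The centre in the annihilator sense, for a commutative product. *)
Definition in_centre (x : V) : Prop := forall y, mul x y = 0.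

Definition is_ideal (I : {vspace V}) : Prop :=
  forall x y, x \in I -> mul x y \in I /\ mul y x \in I.

Definition has_central_component : Prop :=
  exists I1 I2 : {vspace V},
    [/\ is_ideal I1 /\ is_ideal I2,
        (I1 + I2)%VS = fullv, directv (I1 + I2),
        I2 != 0%VS & forall x, x \in I2 -> in_centre x].

End Algebra.

Definition alg_isomorphic (K : fieldType) (V W : vectType K)
    (mulV : {bilinear V -> V -> V}) (mulW : {bilinear W -> W -> W}) : Prop :=
  exists f : {linear V -> W},
    bijective f /\ {morph f : x y / mulV x y >-> mulW x y}.

(* A multiplication table for the standard basis e of 'rV_4: an entry (i, j, k)
   stands for e_i o e_j = e_k, and for e_j o e_i = e_k; products of basis
   vectors with no entry are zero. *)
Definition mul_table := seq ('I_4 * 'I_4 * 'I_4).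

Definition table_basis_mul (K : fieldType) (t : mul_table) (i j : 'I_4) :
    'rV[K]_4 :=
  \sum_(k | ((i, j, k) \in t) || ((j, i, k) \in t)) delta_mx 0 k.

Definition table_mul (K : fieldType) (t : mul_table) (x y : 'rV[K]_4) :
    'rV[K]_4 :=
  \sum_i \sum_j (x 0 i * y 0 j) *: table_basis_mul K t i j.

Lemma table_mul_is_bilinear (K : fieldType) (t : mul_table) :
  bilinear_for *:%R *:%R (@table_mul K t).
Proof.
split=> [y k x x'|x k y y']; rewrite /table_mul /= scaler_sumr -big_split /=;
  apply: eq_bigr => i _; rewrite scaler_sumr -big_split /=;
  apply: eq_bigr => j _; rewrite scalerA -scalerDl !mxE.
  by rewrite mulrDl mulrA.
by rewrite mulrDr mulrCA.
Qed.

HB.instance Definition _ (K : fieldType) (t : mul_table) :=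
  bilinear_isBilinear.Build K 'rV[K]_4 'rV[K]_4 'rV[K]_4 *:%R *:%R
    (@table_mul K t) (table_mul_is_bilinear K t).

Lemma table_mul_basis (K : fieldType) (t : mul_table) (i j : 'I_4) :
  table_mul t (delta_mx 0 i) (delta_mx 0 j) = table_basis_mul K t i j.
Proof.
rewrite /table_mul (bigD1 i) //= (bigD1 j) //= !mxE !eqxx mulr1 scale1r.
rewrite !big1 ?addr0 // => [i' ni|j' nj].
  by rewrite big1 // => j' _; rewrite !mxE (negPf ni) andbF mul0r scale0r.
by rewrite !mxE (negPf nj) andbF mulr0 scale0r.
Qed.

Local Notation a := (@Ordinal 4 0 isT).
Local Notation b := (@Ordinal 4 1 isT).
Local Notation c := (@Ordinal 4 2 isT).
Local Notation d := (@Ordinal 4 3 isT).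

Definition J4_1 : mul_table := [::].
Definition J4_2 : mul_table := [:: (a, a, b)].
Definition J4_3 : mul_table := [:: (a, a, c); (b, b, c)].
Definition J4_4 : mul_table := [:: (a, a, b); (a, b, c)].
Definition J4_5 : mul_table := [:: (a, a, d); (b, b, d); (c, c, d)].
Definition J4_7 : mul_table := [:: (a, a, b); (a, b, d); (c, c, d)].
Definition J4_11 : mul_table :=
  [:: (a, a, b); (a, b, c); (a, c, d); (b, b, d)].
Definition J4_12 : mul_table := [:: (a, a, c); (a, b, d)].
Definition J4_13 : mul_table := [:: (a, a, c); (b, b, c); (a, b, d)].

Definition J4_with_central_component : seq mul_table :=
  [:: J4_1; J4_2; J4_3; J4_4].
Definition J4_without_central_component : seq mul_table :=
  [:: J4_5; J4_7; J4_11; J4_12; J4_13].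
Definition J4_list : seq mul_table :=
  J4_with_central_component ++ J4_without_central_component.

(* Main.v *)
(* Classification.  The nilpotent algebra A is split by its largest nonvanishing
   powers.  If x^4 != 0 then x, x^2, x^3, x^4 is a basis.  If x^3 != 0 = x^4,
   then nilpotency of multiplication by x provides y outside <x, x^2, x^3> with
   x y = 0, and y^2 is a multiple of x^3.  If all cubes vanish, then all
   products of three elements vanish, since x^2 z != 0 would make x, x^2, x z,
   x^2 z a basis in which z cannot be expanded; what is left is a quadratic map
   A -> A, which is a quadratic form if the squares span a line (it is
   diagonalized), and otherwise vanishes on a product of two linear forms, i.e.
   p q = 0 (with p, q independent or equal) on a pair of generators.

   Non-isomorphism.  The nine algebras are separated by six first-order
   properties: nonvanishing of some square, cube or fourth power, existence of
   x with x^2 = 0 that does not annihilate A, of x and y with x^2 = y^2 = 0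
   and x y != 0, and of a central element that is not a product.  The last one
   is implied by a central component, and fails exactly for the last five
   algebras. *)
Require Import Defs.
From HB Require Import structures.
From Stdlib Require Import Classical.
From mathcomp Require Import all_boot all_order all_algebra.
From mathcomp Require Import ring.

Set Implicit Arguments.
Unset Strict Implicit.
Unset Printing Implicit Defensive.

Import GRing.Theory.
Local Open Scope ring_scope.

(** * The nine tables *)

Section Rows.

Variable K : fieldType.
Implicit Types (t : mul_table) (u v : 'rV[K]_4).

(** The filtered sum of basis vectors becomes a conditional on membership, which reduces by
    computation as soon as the table is concrete. *)
Lemma table_mulE t u v k :
  table_mul t u v 0 k =
  \sum_i \sum_j
    if ((i, j, k) \in t) || ((j, i, k) \in t) then u 0 i * v 0 j else 0.
Proof.
rewrite summxE; apply: eq_bigr => i _; rewrite summxE; apply: eq_bigr => j _.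
rewrite mxE summxE big_mkcond (bigD1 k) //= big1 => [|l nlk].
  by rewrite addr0; case: ifP => _; rewrite ?mulr0 // mxE !eqxx mulr1.
by case: ifP => // _; rewrite mxE eqxx eq_sym (negPf nlk).
Qed.

Definition rv4 (x0 x1 x2 x3 : K) : 'rV[K]_4 :=
  \row_i [:: x0; x1; x2; x3]`_i.

Lemma rv4P u : exists x0 x1 x2 x3, u = rv4 x0 x1 x2 x3.
Proof.
exists (u 0 (inord 0)), (u 0 (inord 1)), (u 0 (inord 2)), (u 0 (inord 3)).
apply/rowP => -[[|[|[|[|//]]]] lti]; rewrite mxE /=;
  by congr (u 0 _); apply: val_inj; rewrite /= inordK.
Qed.

Lemma rv4_inj x0 x1 x2 x3 y0 y1 y2 y3 :
  rv4 x0 x1 x2 x3 = rv4 y0 y1 y2 y3 -> [/\ x0 = y0, x1 = y1, x2 = y2 & x3 = y3].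
Proof.
by move/rowP=> eq_xy; split;
   [have := eq_xy (@Ordinal 4 0 isT) | have := eq_xy (@Ordinal 4 1 isT)
   |have := eq_xy (@Ordinal 4 2 isT) | have := eq_xy (@Ordinal 4 3 isT)];
   rewrite !mxE.
Qed.

Lemma rv4_eq0 x0 x1 x2 x3 :
  (rv4 x0 x1 x2 x3 == 0) = [&& x0 == 0, x1 == 0, x2 == 0 & x3 == 0].
Proof.
have rv4_0 : rv4 0 0 0 0 = 0.
  by apply/rowP => -[[|[|[|[|//]]]] lti]; rewrite !mxE.
apply/eqP/and4P => [|[/eqP-> /eqP-> /eqP-> /eqP->]]; last exact: rv4_0.
by rewrite -rv4_0 => /rv4_inj[-> -> -> ->].
Qed.

Section Products.

Variables x0 x1 x2 x3 y0 y1 y2 y3 : K.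
Let x := rv4 x0 x1 x2 x3.
Let y := rv4 y0 y1 y2 y3.

Ltac compute_product :=
  apply/rowP => -[[|[|[|[|//]]]] lti];
  rewrite table_mulE !big_ord_recl !big_ord0;
  by rewrite !mxE /in_mem /=; ring.

Lemma J4_1E : table_mul J4_1 x y = rv4 0 0 0 0.
Proof. compute_product. Qed.

Lemma J4_2E : table_mul J4_2 x y = rv4 0 (x0 * y0) 0 0.
Proof. compute_product. Qed.

Lemma J4_3E : table_mul J4_3 x y = rv4 0 0 (x0 * y0 + x1 * y1) 0.
Proof. compute_product. Qed.

Lemma J4_4E : table_mul J4_4 x y = rv4 0 (x0 * y0) (x0 * y1 + x1 * y0) 0.
Proof. compute_product. Qed.

Lemma J4_5E : table_mul J4_5 x y = rv4 0 0 0 (x0 * y0 + x1 * y1 + x2 * y2).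
Proof. compute_product. Qed.

Lemma J4_7E : table_mul J4_7 x y =
  rv4 0 (x0 * y0) 0 (x0 * y1 + x1 * y0 + x2 * y2).
Proof. compute_product. Qed.

Lemma J4_11E : table_mul J4_11 x y =
  rv4 0 (x0 * y0) (x0 * y1 + x1 * y0) (x0 * y2 + x2 * y0 + x1 * y1).
Proof. compute_product. Qed.

Lemma J4_12E : table_mul J4_12 x y = rv4 0 0 (x0 * y0) (x0 * y1 + x1 * y0).
Proof. compute_product. Qed.

Lemma J4_13E : table_mul J4_13 x y =
  rv4 0 0 (x0 * y0 + x1 * y1) (x0 * y1 + x1 * y0).
Proof. compute_product. Qed.

End Products.

End Rows.

Section Tables.

Variable K : fieldType.

Definition table_mul_rv4 :=
  (J4_1E, J4_2E, J4_3E, J4_4E, J4_5E, J4_7E, J4_11E, J4_12E, J4_13E).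

(** Every entry leads to an index strictly above those of its two factors, so each further
    multiplication clears one more leading coordinate; after four of them nothing is left. *)
Lemma table_nilpotent (t : mul_table) :
  all (fun e : 'I_4 * 'I_4 * 'I_4 => (e.1.1 < e.2)%N && (e.1.2 < e.2)%N) t ->
  nilpotent_alg (@table_mul K t).
Proof.
move=> /allP t_up; exists 4.
have power0 n : forall v, v \in power_ideal (@table_mul K t) n ->
    forall i : 'I_4, (i < n)%N -> v 0 i = 0.
  elim: n => //= n IHn v Pv i lein.
  rewrite (@coord_span _ _ _ (in_tuple _) v Pv) summxE.
  rewrite big1 // => m _; rewrite mxE.
  have /allpairsP[[u w] /= [Uu _ ->]] := mem_nth 0 (ltn_ord m).
  rewrite table_mulE big1 ?mulr0 // => j _; rewrite big1 // => k _.
  case: ifP => // tjk; rewrite IHn ?mul0r ?vbasis_mem //.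
  suff ltji: (j < i)%N by apply: leq_trans ltji lein.
  by case/orP: tjk => /t_up /= /andP[].
apply/eqP; rewrite -subv0; apply/subvP => v /power0 v0; rewrite memv0.
by apply/eqP/rowP => i; rewrite mxE v0.
Qed.

Lemma J4_ind (P : mul_table -> Prop) :
  P J4_1 -> P J4_2 -> P J4_3 -> P J4_4 -> P J4_5 -> P J4_7 -> P J4_11 ->
  P J4_12 -> P J4_13 -> forall t, t \in J4_list -> P t.
Proof.
move=> P1 P2 P3 P4 P5 P7 P11 P12 P13 t; rewrite mem_cat !inE -!orbA.
by do 8![case/orP=> [/eqP->//|]]; move/eqP->.
Qed.

Lemma J4_comm_nilp_assoc (t : mul_table) :
  t \in J4_list -> comm_nilp_assoc (@table_mul K t).
Proof.
move=> t_J; split.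
- move=> u v; have [x0 [x1 [x2 [x3 ->]]]] := rv4P u.
  have [y0 [y1 [y2 [y3 ->]]]] := rv4P v; move: t t_J.
  by apply: J4_ind; rewrite /= !table_mul_rv4; congr rv4; ring.
- move=> u v w; have [x0 [x1 [x2 [x3 ->]]]] := rv4P u.
  have [y0 [y1 [y2 [y3 ->]]]] := rv4P v.
  have [z0 [z1 [z2 [z3 ->]]]] := rv4P w; move: t t_J.
  by apply: J4_ind; rewrite /= !table_mul_rv4; congr rv4; ring.
by apply: table_nilpotent; move: t t_J; apply: J4_ind.
Qed.

End Tables.

(** * Pairwise non-isomorphism and central components *)

Lemma alg_isomorphic_sym (K : fieldType) (V W : vectType K)
    (mulV : {bilinear V -> V -> V}) (mulW : {bilinear W -> W -> W}) :
  alg_isomorphic mulV mulW -> alg_isomorphic mulW mulV.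
Proof.
case=> f [[g fK gK] fM].
have g_lin := can2_linear fK gK.
pose gL : {linear W -> V} :=
  HB.pack_for {linear W -> V} g (GRing.isLinear.Build K W V *:%R g g_lin).
exists gL; split; first by exists f.
by move=> x y; apply: (can_inj fK); rewrite fM !gK.
Qed.

(** * The six isomorphism invariants *)

Section Invariants.

Variables (K : fieldType) (V : vectType K) (mul : {bilinear V -> V -> V}).
Local Notation "x ** y" := (mul x y) (at level 40, left associativity).

Definition has_nonzero_square := exists x, x ** x != 0.
Definition has_nonzero_cube := exists x, x ** x ** x != 0.
Definition has_nonzero_fourth_power := exists x, x ** x ** x ** x != 0.
Definition has_noncentral_isotropic := exists x y, x ** x = 0 /\ x ** y != 0.
Definition has_hyperbolic_pair :=
  exists x y, [/\ x ** x = 0, y ** y = 0 & x ** y != 0].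
Definition has_central_nonproduct :=
  exists2 z, forall y, z ** y = 0 & forall x y, x ** y <> z.

(** Truth values are recorded as booleans, so that algebras are separated by comparing concrete
    boolean sequences. *)
Definition has_profile (s c f i h n : bool) :=
  [/\ s <-> has_nonzero_square, c <-> has_nonzero_cube &
      f <-> has_nonzero_fourth_power]
  /\ [/\ i <-> has_noncentral_isotropic, h <-> has_hyperbolic_pair &
         n <-> has_central_nonproduct].

End Invariants.

(** The [I2] component of a factor does not contribute to a product, so all products lie in [I1]; a
    nonzero element of [I2] is central and outside [I1]. *)
Lemma central_component_nonproduct (K : fieldType) (V : vectType K)
    (mul : {bilinear V -> V -> V}) :
  has_central_component mul -> has_central_nonproduct mul.
Proof.
case=> I1 [I2 [[I1id I2id] I12 dI12 I2n0 I2c]].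
exists (vpick I2) => [|x y xy]; first by apply: I2c; rewrite memv_pick.
have split_v v : exists v1 v2, [/\ v1 \in I1, v2 \in I2 & v = v1 + v2].
  have /memv_addP[v1 I1v [v2 I2v ->]] : v \in (I1 + I2)%VS by rewrite I12 memvf.
  by exists v1, v2.
have [x1 [x2 [I1x I2x x_eq]]] := split_v x.
have [y1 [y2 [I1y I2y y_eq]]] := split_v y.
have I1xy : mul x y \in I1.
  rewrite x_eq linearDl /= (I2c x2) // addr0.
  by have [] := I1id x1 y I1x.
have : mul x y \in (I1 :&: I2)%VS by rewrite memv_cap I1xy xy memv_pick.
move: dI12; rewrite directv_addE => /and3P[_ _ /eqP->].
by rewrite memv0 xy vpick0 (negPf I2n0).
Qed.

Section Transport.

Variables (K : fieldType) (V W : vectType K).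
Variables (mulV : {bilinear V -> V -> V}) (mulW : {bilinear W -> W -> W}).

Lemma invariants_transport :
  alg_isomorphic mulV mulW ->
  [/\ has_nonzero_square mulV -> has_nonzero_square mulW,
      has_nonzero_cube mulV -> has_nonzero_cube mulW &
      has_nonzero_fourth_power mulV -> has_nonzero_fourth_power mulW]
  /\ [/\ has_noncentral_isotropic mulV -> has_noncentral_isotropic mulW,
         has_hyperbolic_pair mulV -> has_hyperbolic_pair mulW &
         has_central_nonproduct mulV -> has_central_nonproduct mulW].
Proof.
case=> f [[g fK gK] fM].
have f0 x : (f x == 0) = (x == 0) by rewrite -[in LHS](linear0 f) (can_eq fK).
split; split.
- by case=> x x0; exists (f x); rewrite -!fM f0.
- by case=> x x0; exists (f x); rewrite -!fM f0.
- by case=> x x0; exists (f x); rewrite -!fM f0.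
- by case=> x [y [xx xy]]; exists (f x), (f y); rewrite -!fM f0 xx linear0.
- case=> x [y [xx yy xy]]; exists (f x), (f y).
  by rewrite -!fM f0 xx yy linear0.
case=> z z_c z_np; exists (f z) => [y|x y].
  by rewrite -(gK y) -fM z_c linear0.
by rewrite -(gK x) -(gK y) -fM => /(can_inj fK); apply: z_np.
Qed.

End Transport.

(** Transport along the isomorphism and along its inverse makes each of the six properties
    equivalent on the two sides. *)
Lemma has_profile_inj (K : fieldType) (V W : vectType K)
    (mulV : {bilinear V -> V -> V}) (mulW : {bilinear W -> W -> W})
    s c f i h n s' c' f' i' h' n' :
  alg_isomorphic mulV mulW ->
  has_profile mulV s c f i h n -> has_profile mulW s' c' f' i' h' n' ->
  [:: s; c; f; i; h; n] = [:: s'; c'; f'; i'; h'; n'].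
Proof.
move=> iso_VW [[Vs Vc Vf] [Vi Vh Vn]] [[Ws Wc Wf] [Wi Wh Wn]].
have [[Ts Tc Tf] [Ti Th Tn]] := invariants_transport iso_VW.
have [[Us Uc Uf] [Ui Uh Un]] :=
  invariants_transport (alg_isomorphic_sym iso_VW).
by congr [:: _; _; _; _; _; _]; apply/idP/idP; tauto.
Qed.

(** If no entry mentions the last basis vector, that vector annihilates everything and no product
    has a last coordinate; the decomposition is the hyperplane of zero last coordinate plus the line
    of that vector. *)
Lemma table_central_component (K : fieldType) (t : mul_table) :
  all (fun e : 'I_4 * 'I_4 * 'I_4 =>
         [&& e.1.1 != ord_max, e.1.2 != ord_max & e.2 != ord_max]) t ->
  has_central_component (@table_mul K t).
Proof.
move=> /allP t_max.
have phi_lin : linear (fun v : 'rV[K]_4 => v 0 ord_max : K^o).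
  by move=> k u v; rewrite !mxE.
pose phi : {linear 'rV[K]_4 -> K^o} := HB.pack_for {linear 'rV[K]_4 -> K^o}
  (fun v : 'rV[K]_4 => v 0 ord_max : K^o)
  (GRing.isLinear.Build K 'rV[K]_4 K^o *:%R _ phi_lin).
pose I1 := lker (linfun phi).
have I1P v : (v \in I1) = (v 0 ord_max == 0) by rewrite memv_ker lfunE.
pose d := delta_mx 0 ord_max : 'rV[K]_4.
have mul_max u v : table_mul t u v 0 ord_max = 0.
  rewrite table_mulE big1 // => i _; rewrite big1 // => j _.
  by case: ifP => // /orP[] /t_max /and3P[_ _ /eqP[]].
have mul_d u : table_mul t u d = 0.
  apply/rowP => k; rewrite table_mulE mxE.
  rewrite big1 // => i _; rewrite big1 // => j _.
  case: ifP => // tijk; rewrite mxE /=.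
  suff /negPf-> : j != ord_max by rewrite mulr0.
  by case/orP: tijk => /t_max /and3P[].
have d_mul u : table_mul t d u = 0.
  apply/rowP => k; rewrite table_mulE mxE.
  rewrite big1 // => i _; rewrite big1 // => j _.
  case: ifP => // tijk; rewrite mxE /=.
  suff /negPf-> : i != ord_max by rewrite mul0r.
  by case/orP: tijk => /t_max /and3P[].
exists I1, <[d]>%VS; split.
- split=> x y; first by rewrite !I1P /= !mul_max.
  case/vlineP=> k ->; rewrite linearZl_LR linearZr_LR /= mul_d d_mul.
  by rewrite !scaler0 mem0v.
- apply/eqP; rewrite eqEsubv subvf /=; apply/subvP => v _.
  rewrite -[v](subrK (v 0 ord_max *: d)) memv_add ?memvZ ?memv_line //.
  by rewrite I1P !mxE !eqxx mulr1 subrr.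
- apply/directv_addP/eqP; rewrite -subv0; apply/subvP => v.
  rewrite memv_cap I1P memv0 => /andP[/[swap] /vlineP[k ->]].
  by rewrite !mxE !eqxx mulr1 => /eqP->; rewrite scale0r.
- suff d_neq0 : d != 0.
    by apply: contra d_neq0 => /eqP d0; rewrite -memv0 -d0 memv_line.
  by apply/eqP => /rowP/(_ ord_max)/eqP; rewrite !mxE !eqxx oner_eq0.
- by move=> x /vlineP[k ->] y; rewrite linearZl_LR /= d_mul scaler0.
Qed.

Lemma sqrt_exists (K : closedFieldType) (k : K) : exists r, r * r = k.
Proof.
(* The coefficients encode the equation X^2 = k + 0 X. *)
have [r r2] :=
  solve_monicpoly (fun i => if i is 0 then k else 0) (isT : (0 < 2)%N).
exists r; rewrite -expr2 r2 !big_ord_recl big_ord0 /= expr0; ring.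
Qed.

Lemma sqr_eq0 (R : idomainType) (x : R) : (x * x == 0) = (x == 0).
Proof. by rewrite mulf_eq0 orbb. Qed.

(** * Values of the invariants on the nine tables *)

Section TableProfiles.

Variable K : closedFieldType.
Hypothesis char_neq2 : 2%N \notin [pchar K].

Lemma two_neq0 : 1 + 1 != 0 :> K.
Proof. by apply: contra char_neq2 => K2; rewrite inE /=. Qed.

Let simp := (table_mul_rv4, mul0r, mulr0, mul1r, mulr1, addr0, add0r, rv4_eq0,
  oner_eq0, eqxx).

Ltac coordinates u x0 x1 x2 x3 :=
  have [x0 [x1 [x2 [x3 ->]]]] := rv4P u.

Ltac no_nonzero_power :=
  split=> // -[u]; have [? [? [? [? ->]]]] := rv4P u; rewrite /= !simp.

Ltac nonzero_power w :=
  split=> // _; exists w; rewrite /= !simp.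

Let a : 'rV[K]_4 := rv4 1 0 0 0.
Let b : 'rV[K]_4 := rv4 0 1 0 0.
Let c : 'rV[K]_4 := rv4 0 0 1 0.
Let d : 'rV[K]_4 := rv4 0 0 0 1.

Ltac no_such_pair u x0 x1 x2 x3 v y0 y1 y2 y3 :=
  split=> // -[u [v []]]; coordinates u x0 x1 x2 x3; coordinates v y0 y1 y2 y3.

Lemma J4_1_profile :
  has_profile (@table_mul K J4_1) false false false false false true.
Proof.
split; split; try by no_nonzero_power.
- by no_such_pair u x0 x1 x2 x3 v y0 y1 y2 y3; rewrite /= !simp.
- by no_such_pair u x0 x1 x2 x3 v y0 y1 y2 y3; rewrite /= !simp.
- by split=> // _; apply/central_component_nonproduct/table_central_component.
Qed.

Lemma J4_2_profile :
  has_profile (@table_mul K J4_2) true false false false false true.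
Proof.
split; split; try by [nonzero_power a | no_nonzero_power].
- no_such_pair u x0 x1 x2 x3 v y0 y1 y2 y3.
  by move/eqP; rewrite /= !simp sqr_eq0 => /= /andP[/eqP-> _]; rewrite !simp.
- no_such_pair u x0 x1 x2 x3 v y0 y1 y2 y3.
  by move/eqP; rewrite /= !simp sqr_eq0 => /= /andP[/eqP-> _]; rewrite !simp.
- by split=> // _; apply/central_component_nonproduct/table_central_component.
Qed.

(** On the first two coordinates both tables carry the form x0 y0 + x1 y1, for which (1, r) and (1,
    -r) with r^2 = -1 are isotropic and have product 2. *)
Lemma J4_3_5_hyperbolic_pair (t : mul_table) : t = J4_3 \/ t = J4_5 ->
  has_hyperbolic_pair (@table_mul K t).
Proof.
have [r r2] := sqrt_exists (-1 : K) => t35.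
exists (rv4 1 r 0 0), (rv4 1 (- r) 0 0).
case: t35 => ->; split; [apply/eqP | apply/eqP | | apply/eqP | apply/eqP | ];
  rewrite /= !simp ?mulrNN ?mulrN ?r2 ?opprK ?subrr ?eqxx //= ?andbT;
  exact: two_neq0.
Qed.

Lemma hyperbolic_isotropic (t : mul_table) :
  has_hyperbolic_pair (@table_mul K t) ->
  has_noncentral_isotropic (@table_mul K t).
Proof. by case=> x [y [xx _ xy]]; exists x, y. Qed.

Lemma J4_3_profile :
  has_profile (@table_mul K J4_3) true false false true true true.
Proof.
split; split; try by [nonzero_power a | no_nonzero_power].
- by split=> // _; apply/hyperbolic_isotropic/J4_3_5_hyperbolic_pair; left.
- by split=> // _; apply/J4_3_5_hyperbolic_pair; left.
- by split=> // _; apply/central_component_nonproduct/table_central_component.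
Qed.

Lemma J4_4_profile :
  has_profile (@table_mul K J4_4) true true false true false true.
Proof.
split; split; try by [nonzero_power a | no_nonzero_power].
- by split=> // _; exists b, a; split; [apply/eqP |]; rewrite /= !simp.
- no_such_pair u x0 x1 x2 x3 v y0 y1 y2 y3.
  move=> /eqP u2 /eqP v2; move: u2 v2; rewrite /= !simp !sqr_eq0 /=.
  by move=> /andP[/eqP-> _] /andP[/eqP-> _]; rewrite !simp.
- by split=> // _; apply/central_component_nonproduct/table_central_component.
Qed.

Lemma J4_5_profile :
  has_profile (@table_mul K J4_5) true false false true true false.
Proof.
split; split; try by [nonzero_power a | no_nonzero_power].
- by split=> // _; apply/hyperbolic_isotropic/J4_3_5_hyperbolic_pair; right.
- by split=> // _; apply/J4_3_5_hyperbolic_pair; right.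
(* Testing [z] against basis vectors shows that it is z3 [d], which is the product of [a] and z3
   [a]. The four profiles below refute the last property in the same way, by writing each central
   element as a multiple of [a] in the algebra. *)
split=> // -[z]; coordinates z z0 z1 z2 z3 => z_c.
have /eqP := z_c a; have /eqP := z_c b; have /eqP := z_c c.
rewrite /= !simp /= => /eqP-> /eqP-> /eqP->.
by move/(_ a (rv4 z3 0 0 0)); rewrite /= !simp.
Qed.

Lemma J4_7_profile :
  has_profile (@table_mul K J4_7) true true false true false false.
Proof.
split; split; try by [nonzero_power a | no_nonzero_power].
- by split=> // _; exists b, a; split; [apply/eqP |]; rewrite /= !simp.
- no_such_pair u x0 x1 x2 x3 v y0 y1 y2 y3.
  (* A zero square forces first x0 = 0 and then x2 = 0; two combinations of [b] and [d] have product
     zero. *)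
  move=> /eqP u2 /eqP v2; move: u2 v2; rewrite /= !simp !sqr_eq0 /=.
  move=> /andP[/eqP-> +] /andP[/eqP-> +]; rewrite !simp !sqr_eq0.
  by move=> /= /eqP-> /eqP->; rewrite !simp.
split=> // -[z]; coordinates z z0 z1 z2 z3 => z_c.
have /eqP := z_c a; have /eqP := z_c c.
rewrite /= !simp /= => /eqP-> /andP[/eqP-> /eqP->].
by move/(_ a (rv4 0 z3 0 0)); rewrite /= !simp.
Qed.

Lemma J4_11_profile :
  has_profile (@table_mul K J4_11) true true true true false false.
Proof.
split; split; try by [nonzero_power a | no_nonzero_power].
- by split=> // _; exists c, a; split; [apply/eqP |]; rewrite /= !simp.
- no_such_pair u x0 x1 x2 x3 v y0 y1 y2 y3.
  move=> /eqP u2 /eqP v2; move: u2 v2; rewrite /= !simp !sqr_eq0 /=.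
  move=> /and3P[/eqP-> _ +] /and3P[/eqP-> _ +]; rewrite !simp !sqr_eq0.
  by move=> /= /eqP-> /eqP->; rewrite !simp.
split=> // -[z]; coordinates z z0 z1 z2 z3 => z_c.
have /eqP := z_c a.
rewrite /= !simp /= => /and3P[/eqP-> /eqP-> /eqP->].
by move/(_ a (rv4 0 0 z3 0)); rewrite /= !simp.
Qed.

Lemma J4_12_profile :
  has_profile (@table_mul K J4_12) true false false true false false.
Proof.
split; split; try by [nonzero_power a | no_nonzero_power].
- by split=> // _; exists b, a; split; [apply/eqP |]; rewrite /= !simp.
- no_such_pair u x0 x1 x2 x3 v y0 y1 y2 y3.
  move=> /eqP u2 /eqP v2; move: u2 v2; rewrite /= !simp !sqr_eq0 /=.
  by move=> /andP[/eqP-> _] /andP[/eqP-> _]; rewrite !simp.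
split=> // -[z]; coordinates z z0 z1 z2 z3 => z_c.
have /eqP := z_c a.
rewrite /= !simp /= => /andP[/eqP-> /eqP->].
by move/(_ a (rv4 z2 z3 0 0)); rewrite /= !simp.
Qed.

(** As 2 is invertible, the second equation makes one coordinate vanish, and the first then makes
    the other vanish. *)
Lemma J4_13_isotropic (x0 x1 : K) :
  x0 * x0 + x1 * x1 = 0 -> x0 * x1 + x1 * x0 = 0 -> x0 = 0 /\ x1 = 0.
Proof.
rewrite [x1 * x0]mulrC -mulr2n -mulr_natl => sq0 /eqP.
rewrite mulf_eq0 [2%:R]/(1 + 1) (negPf two_neq0) /= mulf_eq0.
by case/orP=> /eqP x_0; rewrite x_0 !simp in sq0 *;
  split=> //; apply/eqP; rewrite -sqr_eq0 sq0.
Qed.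

Lemma J4_13_profile :
  has_profile (@table_mul K J4_13) true false false false false false.
Proof.
split; split; try by [nonzero_power a | no_nonzero_power].
- no_such_pair u x0 x1 x2 x3 v y0 y1 y2 y3.
  move/eqP; rewrite /= !simp /= => /andP[/eqP sq0 /eqP pr0].
  by have [-> ->] := J4_13_isotropic sq0 pr0; rewrite !simp.
- no_such_pair u x0 x1 x2 x3 v y0 y1 y2 y3.
  move/eqP; rewrite /= !simp /= => /andP[/eqP sq0 /eqP pr0].
  by have [-> ->] := J4_13_isotropic sq0 pr0; rewrite !simp.
split=> // -[z]; coordinates z z0 z1 z2 z3 => z_c.
have /eqP := z_c a.
rewrite /= !simp /= => /andP[/eqP-> /eqP->].
by move/(_ a (rv4 z2 z3 0 0)); rewrite /= !simp.
Qed.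

(* In the order of J4_list. *)
Definition J4_profiles : seq (seq bool) :=
  [:: [:: false; false; false; false; false; true];
      [:: true; false; false; false; false; true];
      [:: true; false; false; true; true; true];
      [:: true; true; false; true; false; true];
      [:: true; false; false; true; true; false];
      [:: true; true; false; true; false; false];
      [:: true; true; true; true; false; false];
      [:: true; false; false; true; false; false];
      [:: true; false; false; false; false; false]].

(** A left inverse of the map from tables to profiles: the injectivity of that map is thus checked
    table by table, by computation. *)
Definition table_of_profile (p : seq bool) : mul_table :=
  nth J4_1 J4_list (index p J4_profiles).

Lemma J4_profileP (t : mul_table) : t \in J4_list ->
  exists s c f i h n, has_profile (@table_mul K t) s c f i h n
    /\ table_of_profile [:: s; c; f; i; h; n] = t.
Proof.
move: t; apply: J4_ind;
  [have p := J4_1_profile | have p := J4_2_profile | have p := J4_3_profile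
  |have p := J4_4_profile | have p := J4_5_profile | have p := J4_7_profile
  |have p := J4_11_profile | have p := J4_12_profile | have p := J4_13_profile];
  by do 6 eexists; split; first exact: p.
Qed.

Lemma J4_not_isomorphic (t u : mul_table) :
  t \in J4_list -> u \in J4_list -> t != u ->
  ~ alg_isomorphic (@table_mul K t) (@table_mul K u).
Proof.
move=> /J4_profileP[? [? [? [? [? [? [t_p t_eq]]]]]]].
move=> /J4_profileP[? [? [? [? [? [? [u_p u_eq]]]]]]] neq_tu iso_tu.
case/eqP: neq_tu; rewrite -t_eq -u_eq; congr table_of_profile.
exact: has_profile_inj iso_tu t_p u_p.
Qed.

Lemma J4_has_central_component (t : mul_table) :
  t \in J4_with_central_component -> has_central_component (@table_mul K t).
Proof.
by move=> t_J; apply: table_central_component; move: t t_J; apply/allP.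
Qed.

Lemma J4_no_central_component (t : mul_table) :
  t \in J4_without_central_component ->
  ~ has_central_component (@table_mul K t).
Proof.
move=> t_J /central_component_nonproduct; move: t_J; rewrite !inE.
by case/or4P=> [/eqP->|/eqP->|/eqP->|/orP[]/eqP->];
  [have [_ [_ _ [_ n]]] := J4_5_profile | have [_ [_ _ [_ n]]] := J4_7_profile
  |have [_ [_ _ [_ n]]] := J4_11_profile | have [_ [_ _ [_ n]]] := J4_12_profile
  |have [_ [_ _ [_ n]]] := J4_13_profile]; move/n.
Qed.

End TableProfiles.

(** * Classification *)

(* Adjoining a unit turns the algebra into a commutative ring, in which the ring
   tactic proves identities between linear combinations of products. *)
Section Unitization.

Variables (K : fieldType) (V : vectType K) (mul : {bilinear V -> V -> V}).
Hypotheses (mulC : commutative mul) (mulA : associative mul).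

(** The two proofs are parameters of the type because the ring structure declared on it depends on
    them. *)
Definition unitization of commutative mul & associative mul := (K * V)%type.
Local Notation U := (unitization mulC mulA).

HB.instance Definition _ := GRing.Zmodule.copy U (K * V)%type.

Let umul (x y : U) : U := (x.1 * y.1, x.1 *: y.2 + y.1 *: x.2 + mul x.2 y.2).
Let uone : U := (1, 0).

Fact umulA : associative umul.
Proof.
move=> [k u] [l v] [m w]; congr pair; rewrite /= ?mulrA //.
rewrite !(linearDr, linearDl, linearZl_LR, linearZr_LR) /= mulA.
rewrite !scalerDr !scalerA [m * k]mulrC [m * l]mulrC -!addrA.
congr (_ + (_ + _)); rewrite addrCA; congr (_ + _); rewrite [RHS]addrCA.
by congr (_ + _); rewrite addrCA.
Qed.

Fact umulC : commutative umul.
Proof.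
move=> [k u] [l v]; congr pair; rewrite /= 1?mulrC //.
by rewrite mulC [k *: v + _]addrC.
Qed.

Fact umul1 : left_id uone umul.
Proof.
move=> [k u]; congr pair; rewrite /= ?mul1r //.
by rewrite scale1r scaler0 linear0l !addr0.
Qed.

Fact umulDl : left_distributive umul +%R.
Proof.
move=> [k u] [l v] [m w]; congr pair; rewrite /= ?mulrDl // linearDl /=.
rewrite scalerDl scalerDr -!addrA; congr (_ + _); rewrite addrCA; congr (_ + _).
by rewrite [RHS]addrCA; congr (_ + _); rewrite addrCA.
Qed.

Fact uone_neq0 : uone != 0.
Proof. by apply/eqP => -[/eqP]; rewrite oner_eq0. Qed.

HB.instance Definition _ := GRing.Zmodule_isComNzRing.Build U
  umulA umulC umul1 umulDl uone_neq0.

Definition uscalar (k : K) : U := (k, 0).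
Definition uvector (v : V) : U := (0, v).

(** Declaring [uscalar] a ring morphism lets [ring] carry out the arithmetic of the coefficients as
    well. *)
Fact uscalar_is_zmod_morphism : zmod_morphism uscalar.
Proof. by move=> k l; congr pair; rewrite subr0. Qed.
Fact uscalar_is_monoid_morphism : monoid_morphism uscalar.
Proof.
by split=> // k l; congr pair; rewrite /= linear0l !scaler0 !addr0.
Qed.
HB.instance Definition _ :=
  GRing.isZmodMorphism.Build K U uscalar uscalar_is_zmod_morphism.
HB.instance Definition _ :=
  GRing.isMonoidMorphism.Build K U uscalar uscalar_is_monoid_morphism.

Lemma uvector_inj : injective uvector. Proof. by move=> u v []. Qed.

Lemma uvector0 : uvector 0 = 0. Proof. by []. Qed.
Lemma uvectorN v : uvector (- v) = - uvector v.
Proof. by congr pair; rewrite oppr0. Qed.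
Lemma uvectorD u v : uvector (u + v) = uvector u + uvector v.
Proof. by congr pair; rewrite addr0. Qed.
Lemma uvectorZ k v : uvector (k *: v) = uscalar k * uvector v.
Proof. by congr pair; rewrite /= ?mulr0 // linear0l scaler0 !addr0. Qed.
Lemma uvectorM u v : uvector (mul u v) = uvector u * uvector v.
Proof. by congr pair; rewrite /= ?mulr0 // !scale0r !add0r. Qed.

Definition uvectorE := (uvector0, uvectorN, uvectorD, uvectorZ, uvectorM).

End Unitization.

(** * Linear combinations, free families and generating families *)

Section Spans.

Variables (K : fieldType) (V : vectType K).
Implicit Types (v : V) (X Y : seq V).

Lemma span_cons_lin v a X :
  v \in <<a :: X>>%VS -> exists k, exists2 u, u \in <<X>>%VS & v = k *: a + u.
Proof.
rewrite span_cons => /memv_addP[_ /vlineP[k ->] [u Xu ->]].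
by exists k, u.
Qed.

Lemma span1_lin v a : v \in <<[:: a]>>%VS -> exists k, v = k *: a.
Proof. by rewrite span_seq1 => /vlineP. Qed.

Lemma span2_lin v a b :
  v \in <<[:: a; b]>>%VS -> exists k l, v = k *: a + l *: b.
Proof.
by case/span_cons_lin=> k [_ /span1_lin[l ->] ->]; exists k, l.
Qed.

Lemma span3_lin v a b c :
  v \in <<[:: a; b; c]>>%VS -> exists k l m, v = k *: a + l *: b + m *: c.
Proof.
case/span_cons_lin=> k [_ /span2_lin[l [m ->]] ->].
by exists k, l, m; rewrite -addrA.
Qed.

Lemma span4_lin v a b c d :
  v \in <<[:: a; b; c; d]>>%VS ->
  exists k l m n, v = k *: a + l *: b + m *: c + n *: d.
Proof.
case/span_cons_lin=> k [_ /span3_lin[l [m [n ->]]] ->].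
by exists k, l, m, n; rewrite -!addrA.
Qed.

Lemma free_extend X :
  free X -> (size X < \dim {: V})%N -> exists v, free (v :: X).
Proof.
move=> X_free ltXV.
have /subvPn[v _ Xv] : ~~ (fullv <= <<X>>)%VS.
  apply: contraL ltXV => /dimvS leVX; rewrite -leqNgt.
  exact: leq_trans leVX (dim_span X).
by exists v; rewrite free_cons Xv.
Qed.

Lemma free_generates X :
  free X -> size X = \dim {: V} -> forall v, v \in <<X>>%VS.
Proof.
move=> X_free sizeX v.
suff /span_basis-> : basis_of fullv X by exact: memvf.
by rewrite basisEfree X_free subvf sizeX leqnn.
Qed.

Lemma generates_trans X Y :
  (forall v, v \in <<X>>%VS) -> {subset X <= <<Y>>%VS} ->
  forall v, v \in <<Y>>%VS.
Proof. by move=> X_gen /span_subvP/subvP XY v; apply/XY/X_gen. Qed.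

End Spans.

(** * Recognizing a multiplication table on four generators *)

Section TableIsomorphism.

Variables (K : fieldType) (V : vectType K) (mul : {bilinear V -> V -> V}).
Hypothesis dimV : \dim {: V} = 4%N.

(** Four generators of a space of dimension 4 form a basis. The isomorphism is built from rows to
    [V], where it is an explicit linear combination of [e], and then reversed. *)
Lemma table_isomorphic (t : mul_table) (e : seq V) :
  size e = 4%N -> (forall v, v \in <<e>>%VS) ->
  (forall i j : 'I_4,
    mul e`_i e`_j =
      \sum_(k | ((i, j, k) \in t) || ((j, i, k) \in t)) e`_k) ->
  alg_isomorphic mul (@table_mul K t).
Proof.
move=> /eqP size_e e_gen e_mul; pose X : 4.-tuple V := Tuple size_e.
have X_basis : basis_of fullv X.
  rewrite basisEdim dimV size_tuple leqnn andbT.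
  by apply/subvP => v _; exact: e_gen.
apply: alg_isomorphic_sym.
have [g gE] : exists g : {linear 'rV[K]_4 -> V},
    forall r, g r = \sum_i r 0 i *: e`_i.
  pose g (r : 'rV[K]_4) := \sum_i r 0 i *: e`_i.
  have g_lin : linear g.
    move=> k r s; rewrite /g scaler_sumr -big_split; apply: eq_bigr => i _ /=.
    by rewrite !mxE scalerA scalerDl.
  by exists (HB.pack_for {linear 'rV[K]_4 -> V} g
    (GRing.isLinear.Build K 'rV[K]_4 V *:%R g g_lin)).
exists g; split.
  exists (fun v => \row_i coord X i v) => [r|v].
    by apply/rowP => i; rewrite mxE gE coord_sum_free ?(basis_free X_basis).
  rewrite [RHS](coord_basis X_basis) ?memvf // gE.
  by apply: eq_bigr => i _; rewrite mxE.
have g_delta k : g (delta_mx 0 k) = e`_k.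
  rewrite gE (bigD1 k) //= mxE !eqxx scale1r big1 ?addr0 // => i nik.
  by rewrite mxE (negPf nik) andbF scale0r.
move=> r s; rewrite /= /table_mul linear_sum [in RHS]gE linear_sumlz.
apply: eq_bigr => i _; rewrite [in RHS]gE linear_sum linear_sumr.
apply: eq_bigr => j _; rewrite linearZ linear_sum.
rewrite linearZl_LR linearZr_LR scalerA.
by congr (_ *: _); rewrite e_mul; apply: eq_bigr => k _; rewrite g_delta.
Qed.

End TableIsomorphism.

Section Classification.

Variables (K : closedFieldType) (V : vectType K) (mul : {bilinear V -> V -> V}).
Hypotheses (char_neq2 : 2%N \notin [pchar K]) (dimV : \dim {: V} = 4%N).
Hypotheses (mulC : commutative mul) (mulA : associative mul).
Hypothesis mul_nilpotent : nilpotent_alg mul.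

Local Notation "x ** y" := (mul x y) (at level 40, left associativity).
Local Notation generators e := (forall v, v \in <<(e%R : seq V)>>%VS).
Local Notation isomorphic_to t := (alg_isomorphic mul (@table_mul K t)).

(** Moves an equation between vectors into the unitization, where [ring] accepts it as a
    hypothesis. *)
Ltac unitize H :=
  move/(congr1 (@uvector _ _ _ mulC mulA)): H; rewrite !uvectorE => H.
Ltac unitize_goal := apply: (@uvector_inj _ _ _ mulC mulA); rewrite !uvectorE.
Ltac alg_ring := unitize_goal; ring.

Ltac in_span :=
  first [ by apply: memv_span; rewrite !inE eqxx ?orbT
        | apply: memvD; in_span | apply: memvZ; in_span
        | rewrite memvN; in_span ].

(** Size and generation are discharged from the context; what remains is one equation for each of
    the sixteen products of basis vectors. *)
Ltac table_products e :=
  apply: (@table_isomorphic _ _ _ dimV _ e) => //;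
  move=> [[|[|[|[|//]]]] ?] [[|[|[|[|//]]]] ?];
  rewrite big_mkcond !big_ord_recl big_ord0 /= ?addr0 ?add0r.

(** Being reproduced by multiplication with [z], the vector [w] lies in every power of the algebra.
    The classification uses nilpotency only in this form. *)
Lemma mul_fixed_eq0 z w : z ** w = w -> w = 0.
Proof.
move=> zw; have [n /eqP] := mul_nilpotent.
rewrite -subv0 => /subvP pn0; apply/eqP; rewrite -memv0; apply: pn0.
by elim: n => [|n IHn] /=; rewrite ?memvf // -zw mulC mem_mul_vspace ?memvf.
Qed.

(** Multiplication operators have no nonzero eigenvalue: otherwise [z] could be rescaled to fix
    [w]. *)
Lemma mul_scale_eq0 z w k : z ** w = k *: w -> w != 0 -> k = 0.
Proof.
move=> zw /eqP w0; apply/eqP/negP => /negP k0; case: w0.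
apply: (@mul_fixed_eq0 (k^-1 *: z)).
by rewrite linearZl_LR /= zw scalerA mulVf // scale1r.
Qed.

Let K2 : 2%:R != 0 :> K.
Proof. exact: two_neq0 char_neq2. Qed.

Lemma scale2_inj (u v : V) : 2 *: u = 2 *: v -> u = v.
Proof. exact: scalerI. Qed.

Lemma memv_scale2 (W : {vspace V}) v : 2 *: v \in W -> v \in W.
Proof. by rewrite rpredZeq (negPf K2). Qed.

Lemma double_as_sum (u v : V) : 2 *: u = (u + v) + (u - v).
Proof. alg_ring. Qed.

Lemma double_as_difference (u v : V) : 2 *: v = (u + v) - (u - v).
Proof. alg_ring. Qed.

Lemma polarization x y :
  2 *: (x ** y) = (x + y) ** (x + y) - x ** x - y ** y.
Proof. alg_ring. Qed.

(** * Algebras with a nonzero cube *)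

Section PowerBasis.

Variable x : V.
Local Notation x2 := (x ** x).
Local Notation x3 := (x ** x ** x).
Local Notation x4 := (x ** x ** x ** x).

(** A power that is a combination of higher powers has the form z ** w = w with w that power, so it
    would vanish. *)
Lemma free_powers3 : x3 != 0 -> free [:: x; x2; x3].
Proof.
move=> x3_0; have x2_0 : x2 != 0.
  by apply: contra x3_0 => /eqP->; rewrite linear0l.
have x_0 : x != 0 by apply: contra x2_0 => /eqP->; rewrite linear0l.
rewrite !free_cons span_nil memv0 x3_0 nil_free /= andbT.
apply/andP; split; apply/negP.
  move=> /span2_lin[k [l x_eq]]; case/eqP: x_0.
  by apply: (@mul_fixed_eq0 (k *: x + l *: x2)); rewrite [RHS]x_eq; alg_ring.
move=> /span1_lin[k x_eq]; case/eqP: x2_0.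
by apply: (@mul_fixed_eq0 (k *: x)); rewrite [RHS]x_eq; alg_ring.
Qed.

Lemma isomorphic_J4_11 : x4 != 0 -> isomorphic_to J4_11.
Proof.
move=> x4_0; have x3_0 : x3 != 0.
  by apply: contra x4_0 => /eqP->; rewrite linear0l.
have x2_0 : x2 != 0 by apply: contra x3_0 => /eqP->; rewrite linear0l.
have x_0 : x != 0 by apply: contra x2_0 => /eqP->; rewrite linear0l.
have x_free : free [:: x; x2; x3; x4].
  rewrite !free_cons span_nil memv0 x4_0 nil_free /= andbT.
  apply/and3P; split; apply/negP.
  - move=> /span3_lin[k [l [m x_eq]]]; case/eqP: x_0.
    apply: (@mul_fixed_eq0 (k *: x + l *: x2 + m *: x3)); rewrite [RHS]x_eq.
    alg_ring.
  - move=> /span2_lin[k [l x_eq]]; case/eqP: x2_0.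
    by apply: (@mul_fixed_eq0 (k *: x + l *: x2)); rewrite [RHS]x_eq; alg_ring.
  - move=> /span1_lin[k x_eq]; case/eqP: x3_0.
    by apply: (@mul_fixed_eq0 (k *: x)); rewrite [RHS]x_eq; alg_ring.
have x_gen := free_generates x_free (esym dimV).
(* In the expansion of the fifth power, the lowest remaining coefficient is an eigenvalue of a
   multiplication operator, with the matching power of [x] as eigenvector; so the coefficients
   vanish one after the other. *)
have x5 : x4 ** x = 0.
  have [k [l [m [n x5]]]] := span4_lin (x_gen (x4 ** x)).
  have k0 : k = 0.
    apply: (@mul_scale_eq0 (x4 - l *: x - m *: x2 - n *: x3) x) => //.
    by unitize x5; unitize_goal; ring: x5.
  rewrite k0 in x5; have l0 : l = 0.
    apply: (@mul_scale_eq0 (x3 - m *: x - n *: x2) x2) => //.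
    by unitize x5; unitize_goal; ring: x5.
  rewrite l0 in x5; have m0 : m = 0.
    apply: (@mul_scale_eq0 (x2 - n *: x) x3) => //.
    by unitize x5; unitize_goal; ring: x5.
  rewrite m0 in x5; have n0 : n = 0.
    apply: (@mul_scale_eq0 x x4) => //.
    by unitize x5; unitize_goal; ring: x5.
  by rewrite x5 n0 !scale0r !addr0.
table_products [:: x; x2; x3; x4];
  by unitize x5; unitize_goal; ring: x5.
Qed.

Lemma annihilator_of_cube : x3 != 0 -> x4 = 0 ->
  exists y, free [:: y; x; x2; x3] /\ x ** y = 0.
Proof.
move=> x3_0 x4_0.
have x3_free := free_powers3 x3_0.
have [y y_free] : exists y, free (y :: [:: x; x2; x3]).
  by apply: free_extend; rewrite ?dimV.
have y_gen : generators [:: x; x2; x3; y].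
  apply: free_generates; last by rewrite dimV.
  by rewrite (perm_free (_ : perm_eq _ [:: y; x; x2; x3])) //
    (perm_catC [:: x; x2; x3] [:: y]).
have [k [l [m [n xy]]]] := span4_lin (y_gen (x ** y)).
have yN : y \notin <<[:: x; x2; x3]>>%VS.
  by move: y_free; rewrite free_cons => /andP[].
unitize x4_0.
(* If n != 0, then y can be shifted by a combination z - y of x, x^2, x^3 such
   that x z = n z, which nilpotency forbids. *)
have n0 : n = 0.
  apply/eqP/negP => /negP n0; case/negP: yN.
  pose z := y + (k / n) *: x + ((l + k / n) / n) *: x2
    + ((m + (l + k / n) / n) / n) *: x3.
  have : x ** z = n *: z.
    have kn : n * (k / n) = k by rewrite mulrC divfK.
    have ln : n * ((l + k / n) / n) = l + k / n by rewrite mulrC divfK.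
    have mn : n * ((m + (l + k / n) / n) / n) = m + (l + k / n) / n.
      by rewrite mulrC divfK.
    rewrite /z !scalerDr !scalerA kn ln mn.
    unitize xy; unitize_goal; ring: xy x4_0.
  move=> xz; have [|z0] := eqVneq z 0; last first.
    by case/eqP: n0; exact: mul_scale_eq0 xz z0.
  move/eqP; rewrite /z -!addrA addr_eq0 => /eqP->.
  by rewrite memvN; in_span.
(* With n = 0, this shift removes the terms in [x2] and [x3] from [x ** y]. What remains is k x, so
   that k is an eigenvalue of multiplication by the shifted vector. *)
exists (y - l *: x - m *: x2); split.
  rewrite free_cons x3_free andbT; apply: contra yN => y'_in.
  have -> : y = (y - l *: x - m *: x2) + m *: x2 + l *: x by rewrite !subrK.
  by apply: memvD; [apply: memvD => // |]; in_span.
have xz : x ** (y - l *: x - m *: x2) = k *: x.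
  by rewrite n0 in xy; unitize xy; unitize_goal; ring: xy.
suff k0 : k = 0 by rewrite xz k0 scale0r.
apply: (@mul_scale_eq0 (y - l *: x - m *: x2) x); first by rewrite mulC.
by apply: contra x3_0 => /eqP->; rewrite !linear0l.
Qed.

(** Take y with x y = 0. Multiplying the expansion of y^2 by x^2 and by x isolates its coefficients
    on x and x^2, which therefore vanish. If y^2 is nonzero, its coefficient on y is an eigenvalue,
    so y^2 = n x^3, and a square root of n normalizes y. *)
Lemma isomorphic_J4_4_or_7 : x3 != 0 -> x4 = 0 ->
  isomorphic_to J4_4 \/ isomorphic_to J4_7.
Proof.
move=> x3_0 x4_0; have [y [y_free xy]] := annihilator_of_cube x3_0 x4_0.
have y_gen := free_generates y_free (esym dimV).
have [k [l [m [n yy]]]] := span4_lin (y_gen (y ** y)).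
have xyy : x ** (y ** y) = 0 by rewrite mulA xy linear0l.
have xy' := xy; unitize xy'; have x4' := x4_0; unitize x4'.
have /eqP : l *: x3 = 0.
  transitivity (x ** (x ** (y ** y))); last by rewrite xyy linear0r.
  by rewrite yy; unitize_goal; ring: xy' x4'.
rewrite scaler_eq0 (negPf x3_0) orbF => /eqP l0.
have /eqP : m *: x3 = 0.
  transitivity (x ** (y ** y)); last by [].
  by rewrite yy l0; unitize_goal; ring: xy' x4'.
rewrite scaler_eq0 (negPf x3_0) orbF => /eqP m0.
move: yy; rewrite {}l0 {}m0 => yy.
have [yy0|yy_0] := eqVneq (y ** y) 0.
  have e_gen : generators [:: x; x2; x3; y].
    by apply: generates_trans y_gen _ => u;
      rewrite !inE => /or4P[]/eqP->; in_span.
  left; unitize yy0; table_products [:: x; x2; x3; y];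
    by unitize_goal; ring: xy' x4' yy0.
have k0 : k = 0.
  apply: (@mul_scale_eq0 y (y ** y)) => //.
  by rewrite [in LHS]yy [in RHS]yy; unitize yy; unitize_goal; ring: xy' x4' yy.
move: yy; rewrite {}k0 => yy.
have n_0 : n != 0.
  by apply: contra yy_0 => /eqP n0; rewrite yy n0 !scale0r !addr0.
have [r r2] := sqrt_exists n.
have r_0 : r != 0 by apply: contra n_0 => /eqP r0; rewrite -r2 r0 mul0r.
pose z := r^-1 *: y.
have xz : x ** z = 0 by rewrite /z linearZr_LR /= xy scaler0.
have zz : z ** z = x3.
  rewrite /z linearZr_LR linearZl_LR /= yy !scale0r !add0r !scalerA -r2.
  by rewrite mulrA divfK // mulVf // scale1r.
have y_eq : y = r *: z by rewrite scalerKV.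
(* The definition of [z] is forgotten; only these three equations matter from here on. *)
move: xz zz y_eq; move: z => z xz zz y_eq.
have e_gen : generators [:: x; x2; z; x3].
  apply: generates_trans y_gen _ => u; rewrite !inE.
  case/or4P=> /eqP->; try by in_span.
  by rewrite y_eq; in_span.
right; unitize xz; unitize zz; table_products [:: x; x2; z; x3];
  by unitize_goal; ring: xz x4' zz.
Qed.

End PowerBasis.

(* Linearizing x^3 = 0 only gives 3 x^2 y = 0, void in characteristic 3;
   hence the use of the dimension. *)
Lemma mul3_eq0 : (forall x, x ** x ** x = 0) -> forall x y z, x ** y ** z = 0.
Proof.
move=> cube0.
have sqr_mul0 x z : x ** x ** z = 0.
  apply/eqP/negP => /negP x2z_0.
  have x2_0 : x ** x != 0 by apply: contra x2z_0 => /eqP->; rewrite linear0l.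
  have xz_0 : x ** z != 0.
    by apply: contra x2z_0 => /eqP xz; rewrite -mulA xz linear0r.
  have x_0 : x != 0 by apply: contra x2_0 => /eqP->; rewrite linear0l.
  have x3 := cube0 x; have x3' := x3; unitize x3'.
  have e_free : free [:: x; x ** x; x ** z; x ** x ** z].
    rewrite !free_cons span_nil memv0 x2z_0 nil_free /= andbT.
    apply/and3P; split; apply/negP.
    - move=> /span3_lin[k [l [m x_eq]]]; case/eqP: x_0.
      apply: (@mul_fixed_eq0 (k *: x + l *: z + m *: (x ** z))).
      by rewrite [RHS]x_eq; alg_ring.
    - move=> /span2_lin[k [l x_eq]].
      (* Multiplying the relation by [x] turns every other term into a multiple of the cube of
         [x]. *)
      have /eqP : k *: (x ** x ** z) = 0.
        transitivity (x ** (x ** x)); last by rewrite mulA.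
        by rewrite [in RHS]x_eq; unitize_goal; ring: x3'.
      rewrite scaler_eq0 (negPf x2z_0) orbF => /eqP k0.
      case/eqP: x2_0; apply: (@mul_fixed_eq0 (l *: z)).
      by rewrite [RHS]x_eq k0; alg_ring.
    - move=> /span1_lin[k x_eq]; case/eqP: xz_0.
      by apply: (@mul_fixed_eq0 (k *: x)); rewrite [RHS]x_eq; alg_ring.
  (* All four basis vectors are multiples of [x] in the algebra, so [x ** x] annihilates them, and
     hence also [z]. *)
  have [k [l [m [n z_eq]]]] :=
    span4_lin (free_generates e_free (esym dimV) z).
  by case/eqP: x2z_0; rewrite z_eq; unitize_goal; ring: x3'.
move=> x y z; apply: scale2_inj; rewrite scaler0.
transitivity ((x + y) ** (x + y) ** z - x ** x ** z - y ** y ** z).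
  alg_ring.
by rewrite !sqr_mul0 !subr0.
Qed.

(** * Algebras in which products of three elements vanish *)

Section ProductsOfThreeVanish.

Hypothesis mul3 : forall x y z, x ** y ** z = 0.

Lemma mul3r x y z : x ** (y ** z) = 0. Proof. by rewrite mulA mul3. Qed.

Lemma isomorphic_J4_1 : (forall x, x ** x = 0) -> isomorphic_to J4_1.
Proof.
move=> sqr0; have mul0 x y : x ** y = 0.
  by apply: scale2_inj; rewrite polarization !sqr0 !subr0 scaler0.
apply: (@table_isomorphic _ _ _ dimV _ (vbasis {: V})).
- by rewrite size_tuple.
- by move=> v; rewrite (span_basis (vbasisP _)) memvf.
- by move=> i j; rewrite mul0 big_pred0.
Qed.

(** Since p q = 0, both p + q and p - q have square p^2 + q^2, and their product is p^2 - q^2; these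
    four vectors generate because 2 is invertible. *)
Lemma isomorphic_J4_13_of_orthogonal p q :
  p ** q = 0 -> generators [:: p; q; p ** p; q ** q] -> isomorphic_to J4_13.
Proof.
move=> pq pq_gen.
have e_gen : generators [:: p + q; p - q; p ** p + q ** q; p ** p - q ** q].
  apply: generates_trans pq_gen _ => u; rewrite !inE.
  case/or4P => /eqP->; apply: memv_scale2.
  - by rewrite (double_as_sum p q); in_span.
  - by rewrite (double_as_difference p q); in_span.
  - by rewrite (double_as_sum (p ** p) (q ** q)); in_span.
  - by rewrite (double_as_difference (p ** p) (q ** q)); in_span.
have ppp := mul3 p p p; have qqq := mul3 q q q.
unitize pq; unitize ppp; unitize qqq.
table_products [:: p + q; p - q; p ** p + q ** q; p ** p - q ** q];
 by unitize_goal; ring: pq ppp qqq.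
Qed.

Lemma isomorphic_J4_12_of_isotropic y p :
  p ** p = 0 -> generators [:: y; p; y ** y; y ** p] -> isomorphic_to J4_12.
Proof.
move=> pp e_gen; have yyy := mul3 y y y; have yyp := mul3 y y p.
unitize pp; unitize yyy; unitize yyp.
table_products [:: y; p; y ** y; y ** p];
 by unitize_goal; ring: pp yyy yyp.
Qed.

Lemma isomorphic_J4_12_or_13 x y :
  (forall k, x ** x <> k *: (y ** y)) -> y ** y != 0 ->
  isomorphic_to J4_12 \/ isomorphic_to J4_13.
Proof.
move=> x2_y2 y2_0.
have indep k l : k *: (x ** x) = l *: (y ** y) -> k = 0.
  move=> kl; apply/eqP/negP => /negP k0; case: (x2_y2 (k^-1 * l)).
  by rewrite -scalerA -kl scalerA mulVf // scale1r.
have xy_free : free [:: x; y; x ** x; y ** y].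
  rewrite !free_cons span_nil memv0 y2_0 nil_free /= andbT.
  apply/and3P; split; apply/negP.
  - move=> /span3_lin[k [l [m x_eq]]].
    have x2 : x ** x = k *: (x ** y).
      rewrite {2}x_eq !linearDr !linearZr_LR /= !mul3r.
      by rewrite !scaler0 !addr0.
    have xy : x ** y = k *: (y ** y).
      by rewrite {1}x_eq !linearDl !linearZl_LR /= !mul3 !scaler0 !addr0.
    by case: (x2_y2 (k * k)); rewrite x2 xy scalerA.
  - move=> /span2_lin[k [l y_eq]]; case/eqP: y2_0.
    by rewrite {1}y_eq linearDl !linearZl_LR /= !mul3 !scaler0 addr0.
  - by move=> /span1_lin[k]; exact: x2_y2.
have xy_gen := free_generates xy_free (esym dimV).
have [k [l [m [n xy_eq]]]] := span4_lin (xy_gen (x ** y)).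
(* Multiplying the expansion of [x ** y] by [x] and by [y] gives two relations; eliminating [x ** y]
   between them leaves k^2 x^2 = l^2 y^2, whence k = 0 and then l = 0. *)
have kx : k *: (x ** x) + l *: (x ** y) = 0.
  rewrite -[RHS](mul3r x x y) [in RHS]xy_eq !linearDr !linearZr_LR /= !mul3r.
  by rewrite !scaler0 !addr0.
have ky : k *: (x ** y) + l *: (y ** y) = 0.
  rewrite -[RHS](mul3 x y y) [in RHS]xy_eq !linearDl !linearZl_LR /= !mul3.
  by rewrite !scaler0 !addr0.
have k0 : k = 0.
  apply/eqP; rewrite -sqr_eq0; apply/eqP/(@indep _ (l * l)).
  transitivity (k *: (k *: (x ** x) + l *: (x ** y))
    - l *: (k *: (x ** y) + l *: (y ** y)) + l * l *: (y ** y)).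
    by alg_ring.
  by rewrite kx ky !scaler0 subr0 add0r.
have l0 : l = 0.
  move/eqP: ky; rewrite k0 scale0r add0r scaler_eq0 (negPf y2_0) orbF.
  by move/eqP.
move: xy_eq {kx ky}; rewrite {}k0 {}l0 !scale0r !add0r => xy_eq.
(* If p q = 0, the squares of combinations of p and q are combinations of p^2 and q^2, so the
   generators can be traded for p, q and their squares. *)
have by_factors p q a b c d : p ** q = 0 -> x = a *: p + b *: q ->
    y = c *: p + d *: q -> isomorphic_to J4_13.
  move=> pq x_eq y_eq; apply: (isomorphic_J4_13_of_orthogonal pq).
  have x2 : x ** x = (a * a) *: (p ** p) + (b * b) *: (q ** q).
    by rewrite x_eq; unitize pq; unitize_goal; ring: pq.
  have y2 : y ** y = (c * c) *: (p ** p) + (d * d) *: (q ** q).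
    by rewrite y_eq; unitize pq; unitize_goal; ring: pq.
  apply: generates_trans xy_gen _ => u; rewrite !inE.
  by case/or4P => /eqP->; rewrite ?x2 ?y2 ?x_eq ?y_eq; in_span.
have [m0|m_0] := eqVneq m 0.
  right; apply: (by_factors (x - n *: y) y 1 n 0 1).
  - by rewrite linearBl linearZl_LR /= xy_eq m0 scale0r add0r subrr.
  - by rewrite scale1r subrK.
  - by rewrite scale0r scale1r add0r.
(* The scalars r and s are the roots of m T^2 - T + n, divided by m to be monic. *)
have [r [s [rs_sum rs_prod]]] : exists r s, m * (r + s) = 1 /\ m * (r * s) = n.
  have [r r2] := solve_monicpoly
    (fun i => if i is 0 then - (n / m) else m^-1) (isT : (0 < 2)%N).
  exists r, (m^-1 - r); split; first by rewrite addrC subrK mulfV.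
  move: r2; rewrite !big_ord_recl big_ord0 /= expr0 expr1 => r2.
  have -> : r * (m^-1 - r) = m^-1 * r - r ^+ 2 by ring.
  by rewrite r2 mulr1 addr0 opprD opprK addrCA subrr addr0 mulrC divfK.
(* m x^2 - x y + n y^2 = m (x - r y) (x - s y). *)
pose p := x - r *: y; pose q := x - s *: y.
have pq : p ** q = 0.
  transitivity (x ** x - (r + s) *: (x ** y) + (r * s) *: (y ** y)).
    by rewrite /p /q; alg_ring.
  apply: (scalerI m_0); rewrite scaler0 xy_eq.
  transitivity ((m - m * (r + s) * m) *: (x ** x)
    + (m * (r * s) - m * (r + s) * n) *: (y ** y)); first by alg_ring.
  by rewrite rs_sum rs_prod !mul1r !subrr !scale0r addr0.
have pE : x = p + r *: y by rewrite subrK.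
have qE : q = p + (r - s) *: y by rewrite /q pE; alg_ring.
move: pq qE pE {rs_sum rs_prod}; move: q p => q p pq qE pE.
(* A double root gives q = p, so that p is isotropic; distinct roots allow x and y to be recovered
   from p and q. *)
have [rs|neq_rs] := eqVneq r s.
  left; apply: (@isomorphic_J4_12_of_isotropic y p).
    by rewrite -[RHS]pq qE rs subrr scale0r addr0.
  have xx : x ** x = m^-1 *: (y ** p) + (m^-1 * (r - n)) *: (y ** y).
    apply: (scalerI m_0); rewrite scalerDr !scalerA mulrA mulfV //.
    rewrite scale1r mul1r.
    have : y ** p = x ** y - r *: (y ** y) by rewrite pE; alg_ring.
    by move->; rewrite xy_eq; alg_ring.
  apply: generates_trans xy_gen _ => u; rewrite !inE.
  by case/or4P => /eqP->; rewrite ?xx ?pE; in_span.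
right.
have yE : y = (r - s)^-1 *: q - (r - s)^-1 *: p.
  rewrite -scalerBr qE [p + _]addrC addrK scalerA mulVf ?scale1r //.
  by rewrite subr_eq0.
apply: (by_factors p q (1 - r / (r - s)) (r / (r - s))
  (- (r - s)^-1) (r - s)^-1 pq).
  by rewrite {1}pE {1}yE; alg_ring.
by rewrite {1}yE scaleNr addrC.
Qed.

(** Diagonalization of the binary form with Gram coefficients a, b, c. After a possible exchange of
    u and v, either a is nonzero and v is made orthogonal to u by a Gram-Schmidt step, or a = c =
    0. *)
Lemma orthogonal_generators x u v w a b c :
  generators [:: x; u; v; w] -> x ** u = 0 -> x ** v = 0 ->
  u ** u = a *: w -> u ** v = b *: w -> v ** v = c *: w ->
  exists u' v' a' c', [/\ generators [:: x; u'; v'; w], x ** u' = 0, x ** v' = 0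
    & [/\ u' ** v' = 0, u' ** u' = a' *: w & v' ** v' = c' *: w]].
Proof.
wlog a_or_c0 : u v a c / a != 0 \/ c = 0.
  move=> wlog_a e_gen xu xv uu uv vv.
  have [c0|c_0] := eqVneq c 0; first by apply: wlog_a uu uv vv => //; right.
  have e_gen' : generators [:: x; v; u; w].
    by apply: generates_trans e_gen _ => z;
      rewrite !inE => /or4P[]/eqP->; in_span.
  have vu : v ** u = b *: w by rewrite mulC.
  exact: wlog_a (or_introl c_0) e_gen' xv xu vv vu uu.
move=> e_gen xu xv uu uv vv.
have [a0|a_0] := eqVneq a 0; last first.
  have xv' : x ** (v - (b / a) *: u) = 0.
    by rewrite linearBr linearZr_LR /= xu xv scaler0 subrr.
  have uv' : u ** (v - (b / a) *: u) = 0.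
    by rewrite linearBr linearZr_LR /= uv uu scalerA divfK // subrr.
  exists u, (v - (b / a) *: u), a, (c - b / a * b); split=> //; last split=> //.
    apply: generates_trans e_gen _ => z; rewrite !inE.
    case/or4P => /eqP->; try by in_span.
    by rewrite -[X in X \in _](subrK ((b / a) *: u)); in_span.
  rewrite linearBl linearZl_LR /= uv' scaler0 subr0 linearBr linearZr_LR /=.
  by rewrite vv mulC uv scalerA -scalerBl.
case: a_or_c0 => [|c0]; first by rewrite a0 eqxx.
(* Both u and v are isotropic here, so u + v and u - v are orthogonal, with squares 2 b w and -2 b
   w. *)
exists (u + v), (u - v), (b + b), (- (b + b)).
move: uu vv; rewrite a0 c0 !scale0r => uu vv.
split; rewrite ?linearBr ?linearDr /= ?xu ?xv ?addr0 ?subr0 //.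
  apply: generates_trans e_gen _ => z; rewrite !inE.
  case/or4P => /eqP->; try by in_span.
    by apply: memv_scale2; rewrite (double_as_sum u v); in_span.
  by apply: memv_scale2; rewrite (double_as_difference u v); in_span.
unitize uu; unitize vv; unitize uv.
by split; unitize_goal; ring: uu vv uv.
Qed.

(** The scalar is a square root of a, or 1 if a = 0; it is nonzero so that v can be recovered from
    the scaled vector. *)
Lemma normalize_square w v a : v ** v = a *: w ->
  exists2 r, r != 0 & (r^-1 *: v) ** (r^-1 *: v) = 0 \/
    (r^-1 *: v) ** (r^-1 *: v) = w.
Proof.
move=> vv; have [a0|a_0] := eqVneq a 0.
  by exists 1; rewrite ?oner_eq0 // invr1 scale1r vv a0 scale0r; left.
have [r r2] := sqrt_exists a.
have r_0 : r != 0 by apply: contra a_0 => /eqP r0; rewrite -r2 r0 mul0r.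
exists r => //; right; rewrite linearZr_LR linearZl_LR /= vv !scalerA -r2.
by rewrite mulrA divfK // mulVf // scale1r.
Qed.

(** The number of x, u, v whose square is w is the rank of the form: ranks 1, 2 and 3 give the three
    tables. Exchanging u and v, a single further square may be assumed to be that of u. *)
Lemma isomorphic_of_normal_form x w u v :
  generators [:: x; u; v; w] -> (forall z, w ** z = 0) ->
  x ** x = w -> x ** u = 0 -> x ** v = 0 -> u ** v = 0 ->
  u ** u = 0 \/ u ** u = w -> v ** v = 0 \/ v ** v = w ->
  [\/ isomorphic_to J4_2, isomorphic_to J4_3 | isomorphic_to J4_5].
Proof.
move=> e_gen w0 xx xu xv uv uu vv.
wlog uu_w : u v xu xv uv uu vv e_gen / u ** u = w \/ v ** v = 0.
  move=> wlog_u; case: (vv) => [vv0|vv_w].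
    by apply: (wlog_u u v) => //; right.
  have e_gen' : generators [:: x; v; u; w].
    by apply: generates_trans e_gen _ => z;
      rewrite !inE => /or4P[]/eqP->; in_span.
  by apply: (wlog_u v u) => //; [rewrite mulC | left].
have [wx wu wv ww] := And4 (w0 x) (w0 u) (w0 v) (w0 w).
case: uu => [uu0|{}uu_w]; case: vv => [vv0|vv_w].
- have e_gen' : generators [:: x; w; u; v].
    by apply: generates_trans e_gen _ => z;
      rewrite !inE => /or4P[]/eqP->; in_span.
  constructor 1; table_products [:: x; w; u; v]; by [| rewrite mulC].
(* The exchange leaves this case only for w = 0; every product is then zero, which still matches the
   table of rank 1. *)
- have w_0 : w = 0.
    by case: uu_w => uu_w; [rewrite -uu_w uu0 | rewrite -vv_w uu_w].
  have vv0 : v ** v = 0 by rewrite vv_w.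
  have e_gen' : generators [:: x; w; u; v].
    by apply: generates_trans e_gen _ => z;
      rewrite !inE => /or4P[]/eqP->; in_span.
  constructor 1; table_products [:: x; w; u; v]; by [| rewrite mulC].
- have e_gen' : generators [:: x; u; w; v].
    by apply: generates_trans e_gen _ => z;
      rewrite !inE => /or4P[]/eqP->; in_span.
  constructor 2; table_products [:: x; u; w; v]; by [| rewrite mulC].
- constructor 3; table_products [:: x; u; v; w]; by [| rewrite mulC].
Qed.

(** By polarization all products lie on the line of w, so the product is a symmetric bilinear form.
    Since x is anisotropic, it is split off by subtracting multiples of it from two complementary
    vectors, on which the form is then diagonalized. *)
Lemma isomorphic_J4_2_3_or_5 x :
  x ** x != 0 -> (forall y, exists k, y ** y = k *: (x ** x)) ->
  [\/ isomorphic_to J4_2, isomorphic_to J4_3 | isomorphic_to J4_5].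
Proof.
move=> w_0 sqr_w; set w := x ** x in w_0 sqr_w.
have mul_w y z : exists k, y ** z = k *: w.
  have [[k yz2] [l y2] [m z2]] := And3 (sqr_w (y + z)) (sqr_w y) (sqr_w z).
  exists (2^-1 * (k - l - m)); apply: scale2_inj.
  by rewrite polarization yz2 y2 z2 -!scalerBl scalerA mulrA mulfV ?mul1r.
have wN z : w ** z = 0 by apply: mul3.
have x_free : free [:: x; w].
  rewrite !free_cons span_nil memv0 w_0 nil_free /= andbT.
  apply/negP => /span1_lin[k x_eq]; case/eqP: w_0.
  by rewrite /w {1}x_eq linearZl_LR /= wN scaler0.
have [|u0 u_free] := free_extend x_free; first by rewrite dimV.
have [|v0 v_free] := free_extend u_free; first by rewrite dimV.
have v_gen := free_generates v_free (esym dimV).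
have [[k xu] [l xv]] := (mul_w x u0, mul_w x v0).
have xu' : x ** (u0 - k *: x) = 0 by rewrite linearBr linearZr_LR /= xu subrr.
have xv' : x ** (v0 - l *: x) = 0 by rewrite linearBr linearZr_LR /= xv subrr.
have e_gen : generators [:: x; u0 - k *: x; v0 - l *: x; w].
  apply: generates_trans v_gen _ => z; rewrite !inE => /or4P[]/eqP->.
  - by rewrite -[X in X \in _](subrK (l *: x)); in_span.
  - by rewrite -[X in X \in _](subrK (k *: x)); in_span.
  - by in_span.
  - by in_span.
have [[a uu] [b uv] [c vv]] := And3 (mul_w (u0 - k *: x) (u0 - k *: x))
  (mul_w (u0 - k *: x) (v0 - l *: x)) (mul_w (v0 - l *: x) (v0 - l *: x)).
have {uu uv vv} [u [v [{}a [{}c [{}e_gen {}xu' {}xv' [uv uu vv]]]]]] :=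
  orthogonal_generators e_gen xu' xv' uu uv vv.
have [r r_0 ru] := normalize_square uu.
have [s s_0 sv] := normalize_square vv.
apply: (@isomorphic_of_normal_form x w (r^-1 *: u) (s^-1 *: v)) => //.
- apply: generates_trans e_gen _ => z; rewrite !inE => /or4P[]/eqP->.
  + by in_span.
  + by rewrite -[X in X \in _](scalerKV r_0); in_span.
  + by rewrite -[X in X \in _](scalerKV s_0); in_span.
  + by in_span.
- by rewrite linearZr_LR /= xu' scaler0.
- by rewrite linearZr_LR /= xv' scaler0.
- by rewrite linearZr_LR linearZl_LR /= uv !scaler0.
Qed.

End ProductsOfThreeVanish.

Lemma isomorphic_to_table : exists2 t, t \in J4_list & isomorphic_to t.
Proof.
have [[x x4]|no_x4] := classic (exists x, x ** x ** x ** x != 0).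
  by exists J4_11 => //; exact: isomorphic_J4_11 x4.
have x4_0 x : x ** x ** x ** x = 0.
  by apply/eqP/negP => /negP x4; apply: no_x4; exists x.
have [[x x3]|no_x3] := classic (exists x, x ** x ** x != 0).
  have [iso|iso] := isomorphic_J4_4_or_7 x3 (x4_0 x).
    by exists J4_4.
  by exists J4_7.
have mul3 : forall x y z, x ** y ** z = 0.
  by apply: mul3_eq0 => x; apply/eqP/negP => /negP x3; apply: no_x3; exists x.
have [[x x2]|no_x2] := classic (exists x, x ** x != 0); last first.
  exists J4_1 => //; apply: isomorphic_J4_1 => x.
  by apply/eqP/negP => /negP x2; apply: no_x2; exists x.
have [x_w|/not_all_ex_not[y x_y]] :=
    classic (forall y, exists k, y ** y = k *: (x ** x)).
  by have [] := isomorphic_J4_2_3_or_5 mul3 x2 x_w => iso;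
    [exists J4_2 | exists J4_3 | exists J4_5].
(* The roles are exchanged: it is [x] whose square is known to be nonzero, and that of [y] is off
   its line. *)
have [|//|iso|iso] := @isomorphic_J4_12_or_13 mul3 y x.
- by move=> k xk; apply: x_y; exists k.
- by exists J4_12.
- by exists J4_13.
Qed.

End Classification.

Theorem theorem38 (K : closedFieldType) (char_neq2 : 2%N \notin [pchar K]) :
  (size J4_list = 9%N /\ uniq J4_list) /\
  (\dim {: 'rV[K]_4} = 4%N /\
   forall t, t \in J4_list -> comm_nilp_assoc (@table_mul K t)) /\
  (forall (V : vectType K) (mul : {bilinear V -> V -> V}),
     \dim {: V} = 4%N -> comm_nilp_assoc mul ->
     exists2 t, t \in J4_list & alg_isomorphic mul (@table_mul K t)) /\
  (forall t u, t \in J4_list -> u \in J4_list -> t != u ->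
     ~ alg_isomorphic (@table_mul K t) (@table_mul K u)) /\
  (forall t, t \in J4_with_central_component ->
     has_central_component (@table_mul K t)) /\
  (forall t, t \in J4_without_central_component ->
     ~ has_central_component (@table_mul K t)).
Proof.
split; first by split.
split; first by split; [rewrite dimvf | exact: J4_comm_nilp_assoc].
split; last by split; [exact: J4_not_isomorphic | split;
  [exact: J4_has_central_component | exact: J4_no_central_component]].
move=> V mul dimV [mulC mulA mul_nil].
exact: isomorphic_to_table char_neq2 dimV mulC mulA mul_nil.
Qed.
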